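(* Let $M$ be an irreducible highest weight $\widehat{\mathcal D}$-module with highest weight $\xi\in(\widehat{\mathcal D}_0)^*$, and let $v_\xi$ be a non-zero highest weight vector. Then the following are equivalent: (i) $M$ is quasi-finite; (ii) $\widehat{\mathcal D}_{-\frac12}v_\xi$ is finite dimensional; (iii) there exists $N\in\mathbb N$ such that $\xi=\sum_{j\in\frac12\mathbb N,\ j\le N}\xi_j\omega_j+d\Lambda_0$ for some $\xi_j,d\in\mathbb C$.
   Context: All vector spaces are over $\mathbb C$; $\mathbb N=\{1,2,\dots\}$, $\mathbb Z_+=\{0,1,2,\dots\}$, $\mathbb Z^*=\mathbb Z\setminus\{0\}$. Let $\mathrm{gl}_{\infty|\infty}$ be the space of complex matrices $(a_{ij})_{i,j\in\frac12\mathbb Z}$ with $a_{ij}=0$ for $|i-j|\gg0$; $e_{pq}$ denotes the matrix unit. It is $\frac12\mathbb Z$-graded: the degree-$k$ component consists of all $\sum_{j\in\frac12\mathbb Z}a_je_{j-k,j}$. Elements of integer degree are even, elements of degree in $\frac12+\mathbb Z$ are odd, and $[A,B]=AB-(-1)^{|A||B|}BA$. Let $J=\sum_{r\le0}e_{rr}$, $\mathrm{Str}(D)=\sum_{r}(-1)^{2r}d_{rr}$, $\alpha(A,B)=\mathrm{Str}([J,A]B)$. Then $\widehat{\mathrm{gl}}_{\infty|\infty}=\mathrm{gl}_{\infty|\infty}\oplus\mathbb CC$ is the central extension with $C$ even, central, of degree $0$, and the bracket of $A,B\in\mathrm{gl}_{\infty|\infty}$ equal to $[A,B]+\alpha(A,B)C$.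 Let $\mathcal A\subset \mathrm{gl}_{\infty|\infty}$ be the matrices with $a_{ij}=0$ if $i=0$ or $j=0$; it acts on the superspace $V$ with even basis $e_j$ ($j\in\mathbb Z^*$) and odd basis $e_r$ ($r\in\frac12+\mathbb Z$). Let $(\cdot|\cdot)$ be the bilinear form on $V$ with $(e_i|e_j)=\delta_{i,-j}$ ($i,j\in\mathbb Z^*$), $(e_r|e_s)=\mathrm{sgn}(r)\delta_{r,-s}$ ($r,s\in\frac12+\mathbb Z$), $(e_i|e_r)=(e_r|e_i)=0$. Let $\mathcal D\subset\mathcal A$ be the graded subalgebra spanned by the $A\in \mathcal A$ of parity $\epsilon\in\{0,1\}$ satisfying $(Av|w)=-(-1)^{\epsilon|v|}(v|Aw)$ for all homogeneous $v$ and all $w$ in $V$, and let $\widehat{\mathcal D}=\mathcal D\oplus\mathbb CC\subset\widehat{\mathrm{gl}}_{\infty|\infty}$ with the induced grading. Put $\tilde e_{rr}=e_{rr}-e_{-r,-r}$ for $r\in\frac12\mathbb N$; then $\widehat{\mathcal D}_0=\{\sum_{r\in\frac12\mathbb N}a_r\tilde e_{rr}+dC\}$. Define $\omega_s$ ($s\in\frac12\mathbb N$), $\Lambda_0\in(\widehat{\mathcal D}_0)^*$ by $\omega_s(\sum a_r\tilde e_{rr}+dC)=a_s$, $\Lambda_0(\sum a_r\tilde e_{rr}+dC)=d$. For a $\frac12\mathbb Z$-graded Lie superalgebra $\mathfrak g$ with $\mathfrak g_0$ abelian, put $\mathfrak g_\pm=\bigoplus_{r>0}\mathfrak g_{\pm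 r}$. A highest weight module with highest weight $\xi\in\mathfrak g_0^*$ is a module $M$ containing a non-zero vector $v_\xi$ (highest weight vector) with $hv_\xi=\xi(h)v_\xi$ for $h\in\mathfrak g_0$, $\mathfrak g_+v_\xi=0$, $\mathcal U(\mathfrak g_-)v_\xi=M$. It is graded, $M=\bigoplus_{j\in\frac12\mathbb Z_+}M_{-j}$, by giving $v_\xi$ degree $0$. $M$ is quasi-finite if $\dim M_j<\infty$ for all $j$. *)

(* Defs.v *)
From mathcomp Require Import all_boot all_order all_algebra.
From mathcomp Require Import all_classical all_reals.
From mathcomp Require Export complex.

Set Implicit Arguments.
Unset Strict Implicit.
Unset Printing Implicit Defensive.

Import Order.TTheory GRing.Theory Num.Theory.
Local Open Scope classical_set_scope.
Local Open Scope ring_scope.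

(* The complex numbers are R[i], with R : realType. *)

(* Half-integers are doubled throughout: the integer n stands for n/2, both
   for the indices of matrices and vectors and for degrees.  Thus n is
   a half-odd index or an odd degree exactly when [hodd n]. *)
Definition hodd (n : int) : bool := odd `|n|%N.

Section LinearAlgebra.
Variables (K : fieldType) (E : lmodType K).

Definition span (S : set E) : set E :=
  [set x | exists (n : nat) (c : 'I_n -> K) (s : 'I_n -> E),
     (forall i, S (s i)) /\ x = \sum_(i < n) c i *: s i].

Definition finite_dim (W : set E) : Prop :=
  exists (n : nat) (b : 'I_n -> E), W `<=` span (range b).

Definition subspace (W : set E) : Prop :=
  W 0 /\ (forall (c : K) (x y : E), W x -> W y -> W (c *: x + y)).

Definition superspace (P : bool -> set E) : Prop :=
  (forall e, subspace (P e)) /\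
  (forall x, exists! p : E * E,
     [/\ P false p.1, P true p.2 & x = p.1 + p.2]).

Definition graded_subspace (P : bool -> set E) (W : set E) : Prop :=
  subspace W /\
  (forall x0 x1, P false x0 -> P true x1 -> W (x0 + x1) -> W x0 /\ W x1).

End LinearAlgebra.

Section Matrices.
Variable R : realType.
Local Notation C := R[i].

Definition mat := int -> int -> C.

Definition banded (A : mat) : Prop :=
  exists N : nat, forall i j : int, (N < `|i - j|)%N -> A i j = 0.

(* e_{j-k,j} has degree k, so the entry (i, j) sits in degree j - i. *)
Definition mat_deg (n : int) (A : mat) : Prop :=
  forall i j : int, j - i != n -> A i j = 0.

Definition mat_parity (e : bool) (A : mat) : Prop :=
  forall i j : int, hodd (j - i) != e -> A i j = 0.

Definition mat_part (e : bool) (A : mat) : mat :=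
  fun i j => if hodd (j - i) == e then A i j else 0.

(* The infinite sums below have finite support on the arguments of interest;
   [\sum_(k \in _)] is 0 by convention when the support is infinite. *)
Definition mat_mul (A B : mat) : mat :=
  fun i j => \sum_(k \in [set: int]) A i k * B k j.

Definition mat_sbracket (A B : mat) : mat :=
  fun i j => \sum_(e : bool) \sum_(f : bool)
    (mat_mul (mat_part e A) (mat_part f B) i j
     - (-1) ^+ (e && f) * mat_mul (mat_part f B) (mat_part e A) i j).

Definition matJ : mat := fun i j => ((i == j) && (i <= 0))%:R.

Definition Str (D : mat) : C :=
  \sum_(r \in [set: int]) (-1) ^+ hodd r * D r r.

Definition alpha (A B : mat) : C := Str (mat_mul (mat_sbracket matJ A) B).

Definition calA (A : mat) : Prop :=
  banded A /\ (forall i, A i 0 = 0 /\ A 0 i = 0).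

(* Vectors, as families of coordinates in the basis (e_j), j <> 0. *)
Definition vec := int -> C.

Definition inV (v : vec) : Prop := finite_set [set j | v j != 0] /\ v 0 = 0.

Definition vec_parity (e : bool) (v : vec) : Prop :=
  forall j, hodd j != e -> v j = 0.

Definition mat_act (A : mat) (v : vec) : vec :=
  fun i => \sum_(j \in [set: int]) A i j * v j.

(* (e_i | e_j) *)
Definition gram (i j : int) : C :=
  if j == - i then (if hodd i then (sgz i)%:~R else 1) else 0.

Definition form (v w : vec) : C :=
  \sum_(i \in [set: int]) \sum_(j \in [set: int]) v i * w j * gram i j.

Definition skew_for_form (e : bool) (A : mat) : Prop :=
  forall (f : bool) (v w : vec), inV v -> vec_parity f v -> inV w ->
    form (mat_act A v) w = - (-1) ^+ (e && f) * form v (mat_act A w).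

Definition calD : set (int -> int -> C^o) :=
  span [set A | exists e : bool,
          [/\ calA A, mat_parity e A & skew_for_form e A]].

(* The pair (A, c) stands for A + c C. *)
Definition glhat : lmodType C := ((int -> int -> C^o) * C^o)%type.

Definition hat_bracket (x y : glhat) : glhat :=
  (mat_sbracket x.1 y.1, alpha x.1 y.1).

Definition Dhat : set glhat := [set x | calD x.1].

Definition Dhat_deg (n : int) : set glhat :=
  [set x | [/\ calD x.1, mat_deg n x.1 & n != 0 -> x.2 = 0]].

(* Elements of the dual of Dhat_0 are represented by functions on glhat of
   which only the restriction to [Dhat_deg 0] matters. *)
Definition linear_on_Dhat0 (xi : glhat -> C) : Prop :=
  forall (c : C) (x y : glhat), Dhat_deg 0 x -> Dhat_deg 0 y ->
    xi (c *: x + y) = c * xi x + xi y.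

(* For s > 0, the coefficient of e_ss - e_{-s,-s} is the (s, s) entry. *)
Definition omega (s : int) (x : glhat) : C := x.1 s s.

Definition Lambda0 (x : glhat) : C := x.2.

Section Modules.
Variable M : lmodType C.

(* As for functionals, only the values of [act] on Dhat matter. *)
Record is_Dhat_module (P : bool -> set M) (act : glhat -> M -> M) : Prop := {
  mod_superspace : superspace P;
  mod_linear_l : forall (c : C) (x y : glhat) (m : M), Dhat x -> Dhat y ->
    act (c *: x + y) m = c *: act x m + act y m;
  mod_linear_r : forall (c : C) (x : glhat) (m m' : M), Dhat x ->
    act x (c *: m + m') = c *: act x m + act x m';
  mod_parity : forall (n : int) (e : bool) (x : glhat) (m : M),
    Dhat_deg n x -> P e m -> P (hodd n (+) e) (act x m);
  mod_bracket : forall (k l : int) (x y : glhat) (m : M),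
    Dhat_deg k x -> Dhat_deg l y ->
    act (hat_bracket x y) m =
      act x (act y m) - (-1) ^+ (hodd k && hodd l) *: act y (act x m)
}.

Definition submodule (P : bool -> set M) (act : glhat -> M -> M)
    (W : set M) : Prop :=
  graded_subspace P W /\
  (forall (x : glhat) (m : M), Dhat x -> W m -> W (act x m)).

Definition irreducible (P : bool -> set M) (act : glhat -> M -> M) : Prop :=
  (exists m : M, m != 0) /\
  (forall W : set M, submodule P act W -> W = [set 0] \/ W = setT).

(* [neg_monomial act v n w] : w = x_1 ... x_p v with x_i homogeneous in
   Dhat_- and the (doubled) degrees of the x_i adding up to -n. *)
Inductive neg_monomial (act : glhat -> M -> M) (v : M) : nat -> M -> Prop :=
| neg_monomial_nil : neg_monomial act v 0 v
| neg_monomial_cons (k n : nat) (x : glhat) (w : M) :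
    (0 < k)%N -> Dhat_deg (- k%:Z) x -> neg_monomial act v n w ->
    neg_monomial act v (k + n) (act x w).

(* U(Dhat_-) v *)
Definition U_neg (act : glhat -> M -> M) (v : M) : set M :=
  span [set w | exists n, neg_monomial act v n w].

(* The component M_{-n/2} of M, when v has degree 0. *)
Definition hw_component (act : glhat -> M -> M) (v : M) (n : nat) : set M :=
  span (neg_monomial act v n).

(* M is a highest weight module with highest weight xi, and v is a highest
   weight vector of M. *)
Definition is_hw_vector (act : glhat -> M -> M) (xi : glhat -> C) (v : M) :
    Prop :=
  [/\ v != 0,
      forall h : glhat, Dhat_deg 0 h -> act h v = xi h *: v,
      forall (n : int) (x : glhat), 0 < n -> Dhat_deg n x -> act x v = 0
    & U_neg act v = setT].

Definition quasi_finite (act : glhat -> M -> M) (v : M) : Prop :=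
  forall n : nat, finite_dim (hw_component act v n).

End Modules.
End Matrices.

(* Main.v *)
From Pilot Require Import Defs.
From mathcomp Require Import all_boot all_order all_algebra.
From mathcomp Require Import all_classical all_reals.
From mathcomp Require Import zify ring.
Import Pilot.Defs.

Import Order.TTheory GRing.Theory Num.Theory.
Local Open Scope classical_set_scope.
Local Open Scope ring_scope.

(* (i) => (ii) is clear.

   (ii) => (iii): send a polynomial p to A(p) v, where A(p) in Dhat of degree
   -1/2 has coefficients p(2), p(3), ... along its diagonal (indices doubled).
   By finite dimension some p <> 0 has A(p) v = 0.  Then xi([B, A(p)]) v =
   B A(p) v + A(p) B v = 0 for all B of degree 1/2, and every diagonal element
   supported beyond the roots of p is such a bracket; so xi has finite support.

   (iii) => (i): call x in Dhat of degree -k/2 far if its entries near the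
   origin vanish.  By induction on k, Dhat_+ kills x v when x is sufficiently
   far, so x v = 0: a homogeneous vector of negative degree killed by Dhat_+
   generates a proper submodule, the grading being detected by the element
   diag(i) of Dhat_0.  Commuting far elements through monomials, the far
   elements also kill each M_{-n/2}; as they have finite codimension in each
   degree, M_{-n/2} is finite dimensional by induction on n. *)

Lemma hoddD (m n : int) : hodd (m + n) = hodd m (+) hodd n.
Proof. by rewrite /hodd; lia. Qed.

Lemma hoddN (m : int) : hodd (- m) = hodd m.
Proof. by rewrite /hodd; lia. Qed.

Lemma fsum_single (V : nmodType) (I : choiceType) (k : I) (F : I -> V) :
  (forall i, i != k -> F i = 0) -> \sum_(i \in [set: I]) F i = F k.
Proof.
move=> F0; rewrite -[RHS](fsbig_set1 +%R k F); apply/esym/fsbig_widen => //.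
by move=> i [_ /= /eqP ik]; apply: F0.
Qed.

(** * Spans and finite-dimensional sets *)

Section Span.
Variables (K : fieldType) (E : lmodType K).
Implicit Types (S T W : set E).

Lemma span_sub S W : subspace W -> S `<=` W -> span S `<=` W.
Proof.
move=> [W0 Wlin] SW x [n [c [s [Ss ->]]]].
elim: n c s Ss => [|n IHn] c s Ss; first by rewrite big_ord0.
rewrite big_ord_recl; apply: Wlin; first exact/SW/Ss.
by apply: IHn => i; apply: Ss.
Qed.

Lemma subspace_span S : subspace (span S).
Proof.
split=> [|a x y [n [c [s [Ss ->]]]] [m [d [t [Tt ->]]]]].
  exists 0, (fun=> 0), (fun=> 0); split; first by case.
  by rewrite big_ord0.
pose ct i := match fintype.split i with inl j => a * c j | inr j => d j end.
pose st i := match fintype.split i with inl j => s j | inr j => t j end.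
exists (n + m)%N, ct, st; split; first by rewrite /st => i; case: fintype.split.
rewrite big_split_ord scaler_sumr /ct /st; congr (_ + _); apply: eq_bigr => i _.
  by rewrite -[lshift m i]/(unsplit (inl i)) unsplitK scalerA.
by rewrite -[rshift n i]/(unsplit (inr i)) unsplitK.
Qed.

Lemma span_gen S : S `<=` span S.
Proof.
move=> x Sx; exists 1%N, (fun=> 1), (fun=> x); split=> //.
by rewrite big_ord1 scale1r.
Qed.

Lemma span_mono S T : S `<=` T -> span S `<=` span T.
Proof.
by move=> ST; apply: span_sub; [exact: subspace_span|move=> x /ST; exact: span_gen].
Qed.

Lemma subspaceD W x y : subspace W -> W x -> W y -> W (x + y).
Proof. by move=> [_ /(_ 1 x y)]; rewrite scale1r. Qed.

Lemma subspaceZ W a x : subspace W -> W x -> W (a *: x).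
Proof. by move=> [W0 /(_ a x 0)]; rewrite addr0 => + Wx; apply. Qed.

Lemma subspace_sum W (I : Type) (r : seq I) (F : I -> E) :
  subspace W -> (forall i, W (F i)) -> W (\sum_(i <- r) F i).
Proof.
move=> subW WF; elim: r => [|i r IHr]; first by rewrite big_nil; case: subW.
by rewrite big_cons; apply: subspaceD.
Qed.

Lemma finite_dimP W :
  finite_dim W <-> exists r : seq E, W `<=` span [set x | x \in r].
Proof.
split=> [[n [b Wb]]|[r Wr]].
  exists [seq b i | i <- enum 'I_n] => x /Wb; apply: span_mono => _ [i _ <-] /=.
  by apply: map_f; rewrite mem_enum.
exists (size r), (fun i => r`_i) => x /Wr; apply: span_mono => y /= yr.
have ltyr : (index y r < size r)%N by rewrite index_mem.
by exists (Ordinal ltyr) => //=; rewrite nth_index.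
Qed.

Lemma finite_dim_sub W S : finite_dim S -> W `<=` span S -> finite_dim W.
Proof.
move=> [n [b Sb]] WS; exists n, b => x /WS.
by apply: span_sub => //; apply: subspace_span.
Qed.

Lemma finite_dimU S T : finite_dim S -> finite_dim T -> finite_dim (S `|` T).
Proof.
move=> /finite_dimP[r Sr] /finite_dimP[t Tt]; apply/finite_dimP.
exists (r ++ t) => x [/Sr|/Tt]; apply: span_mono => y /=.
  by rewrite mem_cat => ->.
by rewrite mem_cat orbC => ->.
Qed.

Lemma finite_dim_bigcup (I : eqType) (r : seq I) (F : I -> set E) :
  (forall i, i \in r -> finite_dim (F i)) ->
  finite_dim [set x | exists2 i, i \in r & F i x].
Proof.
elim: r => [|i r IHr] Ffin.
  by exists 0%N, (fun=> 0) => x [].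
apply: (@finite_dim_sub _ (F i `|` [set x | exists2 i, i \in r & F i x])).
  apply: finite_dimU; first by apply: Ffin; rewrite mem_head.
  by apply: IHr => j jr; apply: Ffin; rewrite in_cons jr orbT.
move=> x [j]; rewrite in_cons => /predU1P[->|jr] Fx; apply: span_gen.
  by left.
by right; exists j.
Qed.

Lemma span_linear_image (f : E -> E) S x :
  (forall c x y, f (c *: x + y) = c *: f x + f y) ->
  span S x -> span (f @` S) (f x).
Proof.
move=> flin; apply: (@span_sub S [set x | span (f @` S) (f x)]).
  have f0 : f 0 = 0.
    apply: (@addrI _ (f 0)); rewrite addr0.
    by have := flin 1 0 0; rewrite scaler0 addr0 scale1r => <-.
  split=> /= [|c y z Sy Sz]; first by rewrite f0; case: (subspace_span (f @` S)).
  by rewrite flin; apply: (subspace_span _).2.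
by move=> y Sy; apply: span_gen; exists y.
Qed.

Lemma finite_dim_image (f : E -> E) S :
  (forall c x y, f (c *: x + y) = c *: f x + f y) ->
  finite_dim S -> finite_dim (f @` S).
Proof.
move=> flin /finite_dimP[r Sr]; apply/finite_dimP; exists (map f r).
move=> _ [x /Sr Sx <-]; apply: span_mono (span_linear_image _ _ _ flin Sx).
by move=> _ [y /= yr <-]; apply: map_f.
Qed.

End Span.

(** Splitting off a linear factor at a natural root lowers the size, so the natural roots are
    finitely many. Beyond the bound, [raise_coef] divides by non-zero values only. *)
Lemma poly_nat_roots_bounded (K : numDomainType) (p : {poly K}) :
  p != 0 -> exists n : nat, forall i : nat, (n < i)%N -> p.[i%:R] != 0.
Proof.
have [m] := ubnP (size p); elim: m p => // m IHm p pm p0.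
have [[a pa]|noroot] := pselect (exists a : nat, root p a%:R); last first.
  by exists 0%N => i _; apply: contra_notN noroot => pi0; exists i.
have /factor_theorem[q pq] := pa.
have q0 : q != 0 by apply: contraNneq p0 => q0; rewrite pq q0 mul0r.
have [n qn] : exists n : nat, forall i : nat, (n < i)%N -> q.[i%:R] != 0.
  by apply: IHm => //; move: pm; rewrite pq size_Mmonic ?monicXsubC // size_XsubC addn2.
exists (maxn n a) => i; rewrite gtn_max => /andP[ni ai].
rewrite pq hornerM hornerXsubC mulf_neq0 ?qn // subr_eq0 eqr_nat.
by rewrite neq_ltn ai orbT.
Qed.

Lemma span_range (K : fieldType) (E : lmodType K) (d : nat) (b : 'I_d -> E) x :
  span (range b) x -> exists c : 'I_d -> K, x = \sum_j c j *: b j.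
Proof.
apply: (@span_sub K E _ [set x | exists c : 'I_d -> K, x = \sum_j c j *: b j]).
  split; first by exists (fun=> 0); rewrite big1 // => j _; rewrite scale0r.
  move=> c _ _ [c1 ->] [c2 ->]; exists (fun j => c * c1 j + c2 j).
  rewrite scaler_sumr -big_split; apply: eq_bigr => j _ /=.
  by rewrite scalerDl scalerA.
move=> _ [j _ <-]; exists (fun l => (l == j)%:R).
rewrite (bigD1 j) //= eqxx scale1r big1 ?addr0 // => l /negbTE ->.
by rewrite scale0r.
Qed.

(** The [d + 1] monomials of degree at most [d] are sent into the span of [d] vectors, so their
    coefficient matrix has a non-zero row in its left kernel; its entries are the coefficients of
    [p]. *)
Lemma finite_dim_poly_kernel (K : fieldType) (E : lmodType K)
    (f : {poly K} -> E) (W : set E) :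
  (forall c p q, f (c *: p + q) = c *: f p + f q) ->
  finite_dim W -> (forall p, W (f p)) -> exists2 p, p != 0 & f p = 0.
Proof.
move=> flin [d [b Wb]] Wf.
have /choice[B fB] (i : nat) : exists c : 'I_d -> K, f 'X^i = \sum_j c j *: b j.
  by apply: span_range; apply: Wb.
pose A := \matrix_(i < d.+1, j < d) B i j.
have kerA : kermx A != 0.
  by rewrite kermx_eq0 /row_free neq_ltn ltnS rank_leq_col.
pose c := nz_row (kermx A).
have cA : c *m A = 0 by apply/sub_kermxP; exact: nz_row_sub.
have f0 : f 0 = 0.
  apply: (@addrI _ (f 0)); rewrite addr0.
  by have := flin 1 0 0; rewrite scaler0 addr0 scale1r => <-.
have fsum (I : Type) (r : seq I) (a : I -> K) (u : I -> {poly K}) :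
    f (\sum_(i <- r) a i *: u i) = \sum_(i <- r) a i *: f (u i).
  by elim: r => [|i r IHr]; rewrite ?big_nil // !big_cons flin IHr.
exists (\sum_(i < d.+1) c 0 i *: 'X^i).
  apply: contraNneq kerA => p0; rewrite -nz_row_eq0; apply/eqP/rowP => i.
  have /(congr1 (fun q : {poly K} => q`_i)) := p0.
  rewrite coef_sum coef0 mxE => <-; rewrite (bigD1 i) //= coefZ coefXn eqxx mulr1.
  rewrite big1 ?addr0 // => j ji; rewrite coefZ coefXn eq_sym.
  by rewrite (inj_eq val_inj) (negbTE ji) mulr0.
rewrite fsum; under eq_bigr => i _ do rewrite fB scaler_sumr.
rewrite exchange_big big1 //= => j _.
under eq_bigr => i _ do rewrite scalerA.
rewrite -scaler_suml; have /rowP/(_ j) := cA; rewrite !mxE => E0.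
rewrite (_ : \sum_(i < _) _ = 0) ?scale0r // -[RHS]E0.
by apply: eq_bigr => i _; rewrite mxE.
Qed.

(** * Matrices supported on one diagonal *)

Section Matrices.
Variable R : realType.
Local Notation C := R[i].
Implicit Types (A : mat R) (f g h : int -> C) (n a b : int).

(** The coefficients are indexed by the row. By [mat_degE] every matrix of degree [n] has this form,
    which turns brackets into formulas on functions. *)
Definition hmat n f : mat R := fun i j => if j == i + n then f i else 0.

(** The non-zero Gram entry [gram i (- i)]. *)
Definition gsgn (i : int) : C := if hodd i then (sgz i)%:~R else 1.

Lemma gsgn_neq0 i : gsgn i != 0.
Proof.
rewrite /gsgn; case: ifP => oi; last exact: oner_neq0.
rewrite intr_eq0 sgz_eq0.
by apply/eqP => i0; rewrite i0 in oi.
Qed.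

Lemma mat_degE n A : mat_deg n A -> A = hmat n (fun i => A i (i + n)).
Proof.
move=> degA; apply/funext => i; apply/funext => j; rewrite /hmat.
by case: eqP => [-> //|/eqP jin]; apply: degA; apply: contra jin => /eqP <-; lia.
Qed.

Lemma hmat_deg n f : mat_deg n (hmat n f).
Proof.
move=> i j jin; rewrite /hmat; case: eqP => // ji; move: jin.
by rewrite ji; lia.
Qed.

Lemma banded_hmat n f : banded (hmat n f).
Proof.
exists `|n|%N => i j ij; rewrite /hmat; case: eqP => // ji; move: ij.
by rewrite ji; lia.
Qed.

Lemma hmatE n f i j : hmat n f i j = if j == i + n then f i else 0.
Proof. by []. Qed.

Lemma mat_mul_hmat n f A i j : mat_mul (hmat n f) A i j = f i * A (i + n) j.
Proof.
rewrite /mat_mul (@fsum_single _ _ (i + n)) ?hmatE ?eqxx // => k /negbTE kin.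
by rewrite hmatE kin mul0r.
Qed.

Lemma mat_act_hmat n f (v : vec R) i : mat_act (hmat n f) v i = f i * v (i + n).
Proof.
rewrite /mat_act (@fsum_single _ _ (i + n)) ?hmatE ?eqxx // => k /negbTE kin.
by rewrite hmatE kin mul0r.
Qed.

Lemma formE (v w : vec R) :
  form v w = \sum_(i \in [set: int]) v i * w (- i) * gsgn i.
Proof.
apply: eq_fsbigr => i _; rewrite (@fsum_single _ _ (- i)).
  by rewrite /gram eqxx.
by move=> j /negbTE ji; rewrite /gram ji mulr0.
Qed.

(** Skewness for the form tested on [e_q] and [e_{-p}]. The parity is read off from the position of
    the entry, so the condition is linear in [A] and passes to sums of even and odd elements. *)
Definition skewsym A : Prop := forall p q : int,
  A p q * gsgn p = - (-1) ^+ (hodd (q - p) && hodd q) * (A (- q) (- p) * gsgn q).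

Definition evec (q : int) : vec R := fun i => (i == q)%:R.

Lemma evec_inV q : q != 0 -> inV (evec q).
Proof.
move=> q0; split; last by rewrite /evec eq_sym (negbTE q0).
apply: (sub_finite_set _ (finite_set1 q)) => j /=.
by rewrite /evec; case: (j =P q) => // _; rewrite eqxx.
Qed.

Lemma evec_parity q : vec_parity (hodd q) (evec q).
Proof. by move=> j; rewrite /evec; case: (j =P q) => // ->; rewrite eqxx. Qed.

Lemma mat_act_evec A q i : mat_act A (evec q) i = A i q.
Proof.
rewrite /mat_act (@fsum_single _ _ q) /evec ?eqxx ?mulr1 // => j /negbTE ->.
by rewrite mulr0.
Qed.

Lemma calA_skewsym e A :
  calA A -> mat_parity e A -> skew_for_form e A -> skewsym A.
Proof.
move=> [_ A0] parA skA p q.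
have [p0|p0] := eqVneq p 0.
  by rewrite p0 oppr0 (A0 q).2 (A0 (- q)).1 !mul0r mulr0.
have [q0|q0] := eqVneq q 0.
  by rewrite q0 oppr0 (A0 p).1 (A0 (- p)).2 !mul0r mulr0.
have Np0 : - p != 0 by rewrite oppr_eq0.
have := skA _ _ _ (evec_inV q q0) (evec_parity q) (evec_inV (- p) Np0).
rewrite !formE (@fsum_single _ _ p) => [|i ip]; last first.
  by rewrite /evec eqr_opp (negbTE ip) mulr0 mul0r.
rewrite (@fsum_single _ _ q) => [|i iq]; last first.
  by rewrite /evec (negbTE iq) !mul0r.
rewrite !mat_act_evec /evec !(eqxx, mulr1, mul1r)
  => ->.
have [->//|epq] := eqVneq (hodd (q - p)) e.
by rewrite (parA (- q)) ?mul0r ?mulr0 //; apply: contra epq; rewrite opprK addrC.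
Qed.

Lemma calDP A : calD A ->
  [/\ banded A, forall i, A i 0 = 0 /\ A 0 i = 0 & skewsym A].
Proof.
pose W : set (int -> int -> C^o) :=
  [set A | [/\ banded A, forall i, A i 0 = 0 /\ A 0 i = 0 & skewsym A]].
suff : calD A -> W A by [].
apply: span_sub => [|B [e [calB parB skB]]]; last first.
  by case: (calB) => *; split => //; apply: calA_skewsym parB skB.
split=> [|c B D [[N bB] B0 sB] [[L bD] D0 sD]].
  split=> [|i|p q]; first by exists 0%N.
    by [].
  by rewrite /= !mul0r mulr0.
have E i j : (c *: B + D) i j = c * B i j + D i j :> C by [].
split=> [|i|p q].
- by exists (N + L)%N => i j ij; rewrite E bB ?bD ?mulr0 ?addr0 //; lia.
- by rewrite !E (B0 i).1 (B0 i).2 (D0 i).1 (D0 i).2 !mulr0 !addr0.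
- by rewrite !E mulrDl -mulrA sB sD; ring.
Qed.

(** Characterizes [hmat n f] in [calD]: [f 0] is its entry in row 0, [f (- n)] its entry in column
    0, and the last clause is [skewsym] along the diagonal. *)
Definition hcoef n f : Prop :=
  [/\ f 0 = 0, f (- n) = 0 & forall i, f i * gsgn i =
    - (-1) ^+ (hodd n && hodd (i + n)) * (f (- (i + n)) * gsgn (i + n))].

Lemma calD_hcoef n A : calD A -> hcoef n (fun i => A i (i + n)).
Proof.
move=> /calDP[_ A0 sA]; split; first by rewrite (A0 _).2.
  by rewrite addNr (A0 _).1.
move=> i; rewrite sA; have -> : i + n - i = n by lia.
by have -> : - (i + n) + n = - i by lia.
Qed.

Lemma hcoef_calD n f : hcoef n f -> calD (hmat n f).
Proof.
move=> [f0 fn sf]; apply: span_gen; exists (hodd n); split.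
- split; first exact: banded_hmat.
  move=> i; rewrite /hmat; split; last by rewrite f0 if_same.
  by case: eqP => // /esym/eqP; rewrite addr_eq0 => /eqP ->.
- move=> i j; rewrite /hmat; case: (j =P i + n) => // -> /negP[].
  by have -> : i + n - i = n by lia.
move=> e v w _ parv _; rewrite !formE mulr_fsumr.
(* Shifting by [n] matches each entry with its mirror image, so that the identity holds term by
   term. *)
rewrite [RHS](reindex_fsbigT (fun i : int => i + n)); last first.
  by exists (fun i : int => i - n) => i; rewrite ?addrK ?subrK.
apply: eq_fsbigr => i _ /=; rewrite !mat_act_hmat.
have [<-|oe] := eqVneq (hodd (i + n)) e; last first.
  by rewrite (parv _ oe) !(mulr0, mul0r).
have -> : - (i + n) + n = - i by lia.
transitivity (f i * gsgn i * (v (i + n) * w (- i))); first by ring.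
by rewrite sf; ring.
Qed.

Lemma Dhat_degP n (x : glhat R) : Dhat_deg n x ->
  exists f, [/\ hcoef n f, x.1 = hmat n f & n != 0 -> x.2 = 0].
Proof.
move=> [Dx dx zx]; exists (fun i => x.1 i (i + n)); split=> //.
  exact: calD_hcoef.
exact: mat_degE.
Qed.

Lemma hmat_Dhat_deg n f (c : C) :
  hcoef n f -> (n != 0 -> c = 0) -> Dhat_deg n (hmat n f, c).
Proof. by move=> hf c0; split => //=; [exact: hcoef_calD|exact: hmat_deg]. Qed.

Lemma Dhat_deg_Dhat n (x : glhat R) : Dhat_deg n x -> Dhat x.
Proof. by case. Qed.

Definition brk a b f g : int -> C :=
  fun i => f i * g (i + a) - (-1) ^+ (hodd a && hodd b) * (g i * f (i + b)).

Lemma sbracket_hmat a b f g :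
  mat_sbracket (hmat a f) (hmat b g) = hmat (a + b) (brk a b f g).
Proof.
apply/funext => i; apply/funext => j.
have part e n h : mat_part e (hmat n h) =
    hmat n (fun i => if hodd n == e then h i else 0).
  apply/funext => p; apply/funext => q; rewrite /mat_part /hmat.
  case: (eqVneq q (p + n)) => [->|_]; last by rewrite if_same.
  by have -> : p + n - p = n by lia.
rewrite /mat_sbracket !big_bool /= !part !mat_mul_hmat !hmatE /brk.
rewrite -!addrA [b + a]addrC.
by case: (hodd a); case: (hodd b); case: (j =P i + (a + b)) => _ /=; ring.
Qed.

(** The reflection of positions reverses products: it exchanges the two terms of [brk], up to the
    signs computed in [H1] and [H2]. *)
Lemma brk_hcoef a b f g :
  hcoef a f -> hcoef b g -> hcoef (a + b) (brk a b f g).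
Proof.
move=> [f0 fa sf] [g0 gb sg]; split.
- by rewrite /brk f0 g0 !mul0r mulr0 subr0.
- rewrite /brk; have -> : - (a + b) + a = - b by lia.
  have -> : - (a + b) + b = - a by lia.
  by rewrite fa gb !mulr0 subr0.
move=> i; rewrite /brk.
have -> : - (i + (a + b)) + a = - (i + b) by lia.
have -> : - (i + (a + b)) + b = - (i + a) by lia.
have H1 : f i * g (i + a) * gsgn i = (-1) ^+ (hodd a && hodd (i + a)) *
    (-1) ^+ (hodd b && hodd (i + (a + b))) *
    (f (- (i + a)) * g (- (i + (a + b))) * gsgn (i + (a + b))).
  apply: (mulIf (gsgn_neq0 (i + a))).
  transitivity ((f i * gsgn i) * (g (i + a) * gsgn (i + a))); first by ring.
  by rewrite sf sg -addrA; ring.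
have H2 : g i * f (i + b) * gsgn i = (-1) ^+ (hodd b && hodd (i + b)) *
    (-1) ^+ (hodd a && hodd (i + (a + b))) *
    (g (- (i + b)) * f (- (i + (a + b))) * gsgn (i + (a + b))).
  apply: (mulIf (gsgn_neq0 (i + b))).
  transitivity ((g i * gsgn i) * (f (i + b) * gsgn (i + b))); first by ring.
  by rewrite sf sg -addrA [b + a]addrC; ring.
rewrite mulrBl -mulrA H1 H2 !hoddD.
by case: (hodd a); case: (hodd b); case: (hodd i) => /=; ring.
Qed.

(** Bracketing with [matJ] multiplies an entry by the difference of the indicators of non-positivity
    of its row and column. Only entries crossing between non-positive and positive indices survive,
    and the supertrace sees only total degree 0. *)
Lemma alpha_hmat0 a b f g :
  (a + b = 0 -> forall i, i <= 0 < i + a \/ i + a <= 0 < i ->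
    f i * g (i + a) = 0) ->
  alpha (hmat a f) (hmat b g) = 0.
Proof.
move=> H; have EJ : matJ R = hmat 0 (fun i => (i <= 0)%R%:R).
  apply/funext => i; apply/funext => j; rewrite /matJ /hmat addr0 eq_sym.
  by case: (j =P i).
rewrite /alpha EJ sbracket_hmat /Str fsbig1 // => i _; rewrite mat_mul_hmat hmatE.
case: eqP => [iab|_]; last by rewrite !mulr0.
have {}H := H ltac:(lia) i; rewrite /brk /= mul1r addr0 add0r.
rewrite (_ : _ - _ = ((i <= 0)%R%:R - (i + a <= 0)%R%:R) * f i); last by ring.
rewrite -mulrA; have [i0|i0] := lerP i 0; have [ia0|ia0] := lerP (i + a) 0.
- by rewrite subrr mul0r mulr0.
- by rewrite H ?mulr0 //; left; rewrite i0.
- by rewrite H ?mulr0 //; right; rewrite ia0.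
- by rewrite subrr mul0r mulr0.
Qed.

Lemma hat_bracket_hmat a b f g (c d : C) :
  hat_bracket (hmat a f, c) (hmat b g, d) =
  (hmat (a + b) (brk a b f g), alpha (hmat a f) (hmat b g)).
Proof. by rewrite /hat_bracket sbracket_hmat. Qed.

Lemma hat_bracket_deg a b (x y : glhat R) :
  Dhat_deg a x -> Dhat_deg b y -> Dhat_deg (a + b) (hat_bracket x y).
Proof.
case: x y => [x c] [y d] /Dhat_degP[f [hf /= -> _]] /Dhat_degP[g [hg /= -> _]].
rewrite hat_bracket_hmat; apply: hmat_Dhat_deg; first exact: brk_hcoef.
by move=> ab; apply: alpha_hmat0 => ab0; rewrite ab0 in ab.
Qed.

End Matrices.

(** * Symmetrized elements, far elements and the grading element *)

Section Elements.
Variable R : realType.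
Local Notation C := R[i].
Implicit Types (f g h : int -> C) (n a b : int).

Lemma gsgnN (i : int) : gsgn R (- i) = (-1) ^+ hodd i * gsgn R i.
Proof.
rewrite /gsgn hoddN; case: ifP => _; last by rewrite mul1r.
by rewrite sgzN rmorphN mulN1r.
Qed.

Lemma gsgn_sqr (i : int) : gsgn R i * gsgn R i = 1.
Proof.
rewrite /gsgn; case: ifP => [oi|_]; last by rewrite mulr1.
have i0 : i != 0 by apply/eqP => i0; rewrite i0 in oi.
by rewrite -rmorphM /= mulz_sg i0.
Qed.

(** The factor relating [f i] to its mirror value [f (- (i + n))] in [hcoef], solved for [f i] by
    means of [gsgn_sqr]. *)
Definition refl_coef n (i : int) : C :=
  - (-1) ^+ (hodd n && hodd (i + n)) * gsgn R (i + n) * gsgn R i.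

(* Off the 0-th row and column, twice the projection of [hmat n h] onto
   [calD]. *)
Definition sym n h : int -> C := fun i =>
  if (i == 0) || (i == - n) then 0 else h i + refl_coef n i * h (- (i + n)).

(** The map sending [i] to [- (i + n)] is an involution that exchanges the two excluded rows 0 and
    [- n], and the two summands of [sym]. *)
Lemma sym_hcoef n h : hcoef R n (sym n h).
Proof.
split; rewrite /sym ?eqxx ?orbT // => i.
have -> : (- (i + n) == 0) = (i == - n) by rewrite oppr_eq0 addr_eq0.
have -> : (- (i + n) == - n) = (i == 0).
  by rewrite eqr_opp -{2}[n]add0r; apply/eqP/eqP => [/addIr|->].
rewrite [_ || _]orbC; case: ifP => _; first by rewrite !mul0r mulr0.
rewrite /refl_coef; have -> : - (- (i + n) + n) = i by lia.
have -> : - (i + n) + n = - i by lia.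
rewrite !gsgnN hoddN mulrDl addrC [in RHS]mulrDl [in RHS]mulrDr.
congr (_ + _).
  rewrite -!mulrA [h _ * _]mulrC [X in _ * (_ * X)]mulrA gsgn_sqr mul1r.
  by ring.
have E1 := gsgn_sqr (i + n).
transitivity (h i * gsgn R i * (gsgn R (i + n) * gsgn R (i + n))).
  by rewrite E1 mulr1.
rewrite !hoddD.
by case: (hodd n); case: (hodd i) => /=; ring.
Qed.

Lemma hcoef_refl n f i : hcoef R n f -> f i = refl_coef n i * f (- (i + n)).
Proof.
move=> [_ _ /(_ i) sf]; rewrite -[LHS]mulr1 -(gsgn_sqr i) mulrA sf /refl_coef.
by ring.
Qed.

Definition sym_unit n (j : int) : glhat R :=
  (hmat R n (sym n (fun i => (i == j)%:R)), 0).

Lemma sym_unit_deg n j : Dhat_deg n (sym_unit n j).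
Proof. by apply: hmat_Dhat_deg => //; apply: sym_hcoef. Qed.

Lemma sum_mul_unit (r : seq int) f (i : int) : uniq r -> i \in r ->
  \sum_(j <- r) f j * (i == j)%:R = f i.
Proof.
move=> ur ir; rewrite (bigD1_seq i) //= eqxx mulr1 big1 ?addr0 // => j ji.
by rewrite eq_sym (negbTE ji) mulr0.
Qed.

(* The band |2i + n| <= m of entries of degree n is invariant under the
   symmetry of [calD]. *)
Definition far n (m : int) (x : glhat R) : Prop :=
  [/\ Dhat_deg n x, forall i : int, `|2 * i + n| <= m -> x.1 i (i + n) = 0
    & x.2 = 0].

Lemma far_mono n (m m' : int) x : m' <= m -> far n m x -> far n m' x.
Proof. by move=> mm' [dx fx x2]; split => // i im; apply: fx; lia. Qed.

(** The bracket involves [f i] and [f (i + b)], whose distances [|2 * i + a|] and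
    [|2 * (i + b) + a|] differ from [|2 * i + a + b|] by at most [|b|]. An entry of degree [a]
    crossing the origin has [|2 * i + a| <= |a| <= m], hence vanishes, and no central term
    arises. *)
Lemma far_bracket a b (m : int) (x y : glhat R) : `|a| <= m ->
  far a m x -> Dhat_deg b y -> far (a + b) (m - `|b|) (hat_bracket x y).
Proof.
move=> am [dx fx x2] dy; split; first exact: hat_bracket_deg.
- case: x y dx fx dy {x2} => [x c] [y d] /Dhat_degP[f [hf /= -> _]] + /Dhat_degP.
  move=> fx [g [hg /= -> _]] i im; rewrite sbracket_hmat hmatE eqxx /brk.
  have {}fx j : `|2 * j + a| <= m -> f j = 0.
    by move=> /fx; rewrite hmatE eqxx.
  by rewrite !fx ?(mul0r, mulr0) ?subr0 //; lia.
- case: x y dx fx dy {x2} => [x c] [y d] /Dhat_degP[f [hf /= -> _]] + /Dhat_degP.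
  move=> fx [g [hg /= -> _]]; apply: alpha_hmat0 => ab i ii.
  have := fx i; rewrite hmatE eqxx => ->; rewrite ?mul0r //.
  by apply: le_trans am; case: ii => /andP[]; lia.
Qed.

Lemma fun2_linE (K : nzRingType) (c : K) (A B : int -> int -> K^o) (i j : int) :
  (c *: A + B) i j = c * A i j + B i j.
Proof. by []. Qed.

Lemma pair_linE (K : nzRingType) (E F : lmodType K) (c : K) (x y : E * F) :
  c *: x + y = (c *: x.1 + y.1, c *: x.2 + y.2).
Proof. by []. Qed.

Lemma glhat_linE (c : C) (x y : glhat R) (i j : int) :
  (c *: x + y).1 i j = c * x.1 i j + y.1 i j.
Proof. by rewrite pair_linE /fst fun2_linE. Qed.

Lemma subspace_Dhat : subspace (@Dhat R).
Proof.
have [D0 Dlin] := subspace_span C _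
  [set A : int -> int -> C^o |
    exists e : bool, [/\ calA A, mat_parity e A & skew_for_form e A]].
by split=> [|c x y]; [exact: D0|exact: Dlin].
Qed.

Lemma subspace_Dhat_deg n : subspace (@Dhat_deg R n).
Proof.
have [D0 Dlin] := subspace_Dhat; split=> [|c x y [dx hx zx] [dy hy zy]].
  by split; [exact: D0|move=> i j _|].
split; first exact: Dlin.
  move=> i j ijn; rewrite glhat_linE.
  by rewrite hx // hy // mulr0 addr0.
by move=> n0; rewrite pair_linE /= zx // zy // scaler0 addr0.
Qed.

Lemma mat_sumE (I : Type) (r : seq I) (F : I -> int -> int -> C^o) (i j : int) :
  (\sum_(k <- r) F k) i j = \sum_(k <- r) F k i j.
Proof. exact: (big_morph (fun B : int -> int -> C^o => B i j)). Qed.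

Lemma sum_pairl (I : Type) (r : seq I) (F : I -> int -> int -> C^o) :
  \sum_(k <- r) ((F k, 0) : glhat R) = (\sum_(k <- r) F k, 0).
Proof.
apply/esym/(big_morph (fun B : int -> int -> C^o => (B, 0) : glhat R)) => //.
by move=> A B; congr pair; rewrite addr0.
Qed.

(** A band of width [N] leaves only the degrees from [- N] to [N], and each diagonal of [A] is again
    in [calD]; the central part has degree 0. *)
Lemma Dhat_span_deg (x : glhat R) :
  Dhat x -> span [set y | exists n, Dhat_deg n y] x.
Proof.
case: x => A c /= DA; have [[N bA] _ _] := calDP R A DA.
pose F (k : nat) : int -> int -> C^o :=
  let n := k%:Z - N%:Z in hmat R n (fun i => A i (i + n)).
have -> : (A, c) = 1 *: (0, c) + \sum_(k <- iota 0 (N + N).+1) (F k, 0) :> glhat R.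
  rewrite sum_pairl scale1r; congr pair; rewrite /= ?addr0 // add0r.
  apply/funext => i; apply/funext => j; rewrite mat_sumE /F /hmat.
  have [ijN|ijN] := ltnP N `|i - j|%N.
    by rewrite bA // big1 // => k _; case: eqP => // ji; rewrite -ji bA.
  have kr : `|(j - i + N%:Z)%R|%N \in iota 0 (N + N).+1 by rewrite mem_iota; lia.
  rewrite (bigD1_seq _ kr (iota_uniq _ _)) /=.
  have -> : i + (`|(j - i + N%:Z)%R|%N%:Z - N%:Z) = j by lia.
  rewrite eqxx big1 ?addr0 // => k kn; case: eqP => // jk.
  by move: kn; lia.
have subS := subspace_span C _ [set y : glhat R | exists n, Dhat_deg n y].
apply: subS.2; first apply: span_gen.
  exists 0; split => //; first by case: subspace_Dhat.
apply: subspace_sum => // k; apply: span_gen; exists (k%:Z - N%:Z).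
by apply: hmat_Dhat_deg => //; apply: calD_hcoef.
Qed.

(** The rows from [- (m + |n|)] to [m + |n|]: a generous range containing every [i] with
    [|2 * i + n| <= m], together with its mirror image. *)
Definition near_idx n (m : nat) : seq int :=
  [seq p%:Z - (m + `|n|)%:Z | p <- iota 0 (m + `|n| + m + `|n|).+1].

(** Far elements have finite codimension in each non-zero degree. On the band, the two summands of
    [sym] contribute [f i / 2] each, by [hcoef_refl], which explains the coefficients [f j / 2]. *)
Lemma far_decomp n (m : nat) (x : glhat R) : Dhat_deg n x -> n != 0 ->
  exists c : int -> C,
    far n m (x - \sum_(j <- near_idx n m) c j *: sym_unit n j).
Proof.
move=> dx n0; case: x dx => [x z] /Dhat_degP[f [hf /= -> /(_ n0) ->]].
have ur : uniq (near_idx n m).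
  by rewrite map_inj_uniq ?iota_uniq // => p q; lia.
have inr (i : int) : `|2 * i + n| <= m%:Z -> i \in near_idx n m.
  move=> im; apply/mapP; exists (`|(i + (m + `|n|)%:Z)%R|%N); last by lia.
  by rewrite mem_iota; lia.
exists (fun j => f j / 2); set S := \sum_(_ <- _) _.
have ES : S = (\sum_(j <- near_idx n m) (f j / 2) *:
                  (hmat R n (sym n (fun i => (i == j)%:R)) : int -> int -> C^o), 0).
  by rewrite -sum_pairl; apply: eq_bigr => j _; congr pair; rewrite /= scaler0.
split.
- have [_ subD] := subspace_Dhat_deg n.
  rewrite addrC -scaleN1r; apply: subD; last exact: hmat_Dhat_deg.
  apply: subspace_sum => [|j]; first exact: subspace_Dhat_deg.
  by apply: subspaceZ (sym_unit_deg _ _); exact: subspace_Dhat_deg.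
- rewrite ES => i im.
  have -> (A B : int -> int -> C^o) : (((A, 0) : glhat R) - (B, 0)).1 i (i + n) =
    A i (i + n) - B i (i + n) by [].
  rewrite mat_sumE hmatE eqxx; apply/eqP; rewrite subr_eq0; apply/eqP.
  have Eij j : ((f j / 2) *: (hmat R n (sym n (fun i => (i == j)%:R))
      : int -> int -> C^o)) i (i + n) = f j / 2 * sym n (fun i => (i == j)%:R) i.
    by rewrite -[LHS]/(f j / 2 * hmat R n _ i (i + n)) hmatE eqxx.
  rewrite (eq_bigr _ (fun j _ => Eij j)).
  have [f0 fn _] := hf; rewrite /sym; case: (boolP ((i == 0) || (i == - n))) => [/orP[]/eqP i0|_].
  + by rewrite i0 f0 big1 // => j _; rewrite mulr0.
  + by rewrite i0 fn big1 // => j _; rewrite mulr0.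
  under eq_bigr => j _ do rewrite mulrDr mulrCA.
  have im' : `|2 * - (i + n) + n| <= m%:Z by lia.
  rewrite big_split -big_distrr /=.
  rewrite (sum_mul_unit _ (fun j => f j / 2) _ ur (inr _ im)).
  rewrite (sum_mul_unit _ (fun j => f j / 2) _ ur (inr _ im')).
  by rewrite mulrA -hcoef_refl // -splitr.
- by rewrite ES /= subr0.
Qed.

Definition dgr : glhat R := (hmat R 0 (fun i => i%:~R), 0).

Lemma dgr_deg : Dhat_deg 0 dgr.
Proof.
apply: hmat_Dhat_deg => //; split => // i.
by rewrite addr0 rmorphN /=; ring.
Qed.

Lemma bracket_dgr n (x : glhat R) :
  Dhat_deg n x -> hat_bracket dgr x = (- n)%:~R *: x :> glhat R.
Proof.
case: x => x c /Dhat_degP[f [hf /= -> zx]]; rewrite hat_bracket_hmat add0r.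
congr pair; last first.
  rewrite alpha_hmat0 => [|n0 i]; last by rewrite addr0 => -[]; lia.
  have [->|/zx ->] := eqVneq n 0; last by rewrite scaler0.
  by rewrite oppr0 scale0r.
apply/funext => i; apply/funext => j; rewrite -[RHS]/(_ * _) /= /hmat.
case: eqP => _; last by rewrite mulr0.
by rewrite /brk /= addr0 rmorphN rmorphD /=; ring.
Qed.

End Elements.

(** * Highest weight modules *)

Section Modules.
Variables (R : realType) (M : lmodType R[i]).
Variables (P : bool -> set M) (act : glhat R -> M -> M).
Hypothesis Mmod : is_Dhat_module P act.
Local Notation C := R[i].
Implicit Types (x y : glhat R) (m w s : M) (n a b : int).

Lemma act0l m : act 0 m = 0.
Proof.
have D0 := (subspace_Dhat R).1; apply: (@addrI _ (act 0 m)); rewrite addr0.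
have := mod_linear_l Mmod 1 m D0 D0.
by rewrite scaler0 addr0 scale1r => <-.
Qed.

Lemma act0r x : Dhat x -> act x 0 = 0.
Proof.
move=> Dx; apply: (@addrI _ (act x 0)); rewrite addr0.
by have := mod_linear_r Mmod 1 0 0 Dx; rewrite scaler0 addr0 scale1r => <-.
Qed.

Lemma actZl (c : C) x m : Dhat x -> act (c *: x) m = c *: act x m.
Proof.
move=> Dx; have := mod_linear_l Mmod c m Dx (subspace_Dhat R).1.
by rewrite act0l !addr0.
Qed.

Lemma actDl x y m : Dhat x -> Dhat y -> act (x + y) m = act x m + act y m.
Proof. by move=> Dx Dy; have := mod_linear_l Mmod 1 m Dx Dy; rewrite !scale1r. Qed.

Lemma actZr (c : C) x m : Dhat x -> act x (c *: m) = c *: act x m.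
Proof.
by move=> Dx; have := mod_linear_r Mmod c m 0 Dx; rewrite act0r ?addr0.
Qed.

Lemma actDr x m w : Dhat x -> act x (m + w) = act x m + act x w.
Proof. by move=> Dx; have := mod_linear_r Mmod 1 m w Dx; rewrite !scale1r. Qed.

Lemma act_suml (I : Type) (r : seq I) (F : I -> glhat R) m :
  (forall i, Dhat (F i)) -> act (\sum_(i <- r) F i) m = \sum_(i <- r) act (F i) m.
Proof.
move=> DF; elim: r => [|i r IHr]; first by rewrite !big_nil act0l.
by rewrite !big_cons actDl ?IHr //; apply: subspace_sum => //; exact: subspace_Dhat.
Qed.

Lemma act_sumr (I : Type) (r : seq I) (F : I -> M) x :
  Dhat x -> act x (\sum_(i <- r) F i) = \sum_(i <- r) act x (F i).
Proof.
move=> Dx; elim: r => [|i r IHr]; first by rewrite !big_nil act0r.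
by rewrite !big_cons actDr ?IHr.
Qed.

Lemma subspace_act (W : set M) m :
  subspace W -> subspace [set x | Dhat x /\ W (act x m)].
Proof.
move=> [W0 Wl]; have [D0 Dl] := subspace_Dhat R.
split=> [|c x y [Dx Wx] [Dy Wy]]; first by rewrite /= act0l.
by split; [exact: Dl|rewrite (mod_linear_l Mmod) //; exact: Wl].
Qed.

Lemma act_commute a b x y m : Dhat_deg a x -> Dhat_deg b y ->
  act x (act y m) =
  act (hat_bracket x y) m + (-1) ^+ (hodd a && hodd b) *: act y (act x m).
Proof. by move=> dx dy; rewrite (mod_bracket Mmod _ dx dy) subrK. Qed.

Lemma parity_unique w0 w1 m0 m1 : P false w0 -> P true w1 -> P false m0 ->
  P true m1 -> w0 + w1 = m0 + m1 -> w0 = m0 /\ w1 = m1.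
Proof.
move=> Pw0 Pw1 Pm0 Pm1 wm; have [_ /(_ (w0 + w1))] := mod_superspace Mmod.
move=> [p [_ pE]]; have := pE (w0, w1) (And3 Pw0 Pw1 erefl).
by rewrite (pE (m0, m1) (And3 Pm0 Pm1 wm)) => -[-> ->].
Qed.

(** The vectors having both an even and an odd part in the span form a subspace [W] containing the
    generators; uniqueness of the parts concludes. *)
Lemma graded_span (S : set M) :
  (forall s, S s -> exists e, P e s) -> graded_subspace P (span S).
Proof.
move=> SP; split=> [|m0 m1 Pm0 Pm1 Sm]; first exact: subspace_span.
have subS := subspace_span C M S; have [S0 Sl] := subS.
have subP e : subspace (P e) by have [] := mod_superspace Mmod.
pose W := [set m | exists w0 w1,
  [/\ P false w0 /\ P true w1, span S w0, span S w1 & m = w0 + w1]].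
have [] : W (m0 + m1); last first.
  move=> w0 [w1 [[Pw0 Pw1] Sw0 Sw1 mw]].
  by have [-> ->] := parity_unique _ _ _ _ Pm0 Pm1 Pw0 Pw1 mw.
apply: span_sub Sm; last first.
  move=> s Ss; have [[] Ps] := SP s Ss.
    exists 0, s; split; rewrite ?add0r //; last exact: span_gen.
    by split=> //; case: (subP false).
  exists s, 0; split; rewrite ?addr0 //; last exact: span_gen.
  by split=> //; case: (subP true).
split.
  exists 0, 0; split; rewrite ?addr0 //.
  by split; [case: (subP false)|case: (subP true)].
move=> c x y [x0 [x1 [[Px0 Px1] Sx0 Sx1 ->]]] [y0 [y1 [[Py0 Py1] Sy0 Sy1 ->]]].
exists (c *: x0 + y0), (c *: x1 + y1); split; try exact: Sl.
  by split; [apply: (subP false).2|apply: (subP true).2].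
by rewrite scalerDr addrACA.
Qed.

Lemma neg_monomial0 s w : neg_monomial act s 0 w -> w = s.
Proof.
suff H z : neg_monomial act s z w -> z = 0%N -> w = s by move=> /H; exact.
case=> // k n x {}w k0 _ _.
by move=> /eqP; rewrite addn_eq0 eqn0Ngt k0.
Qed.

(** Its span is U(Dhat_-) applied to [S]. *)
Definition neg_words (S : set M) : set M :=
  [set w | exists (p : nat) s, S s /\ neg_monomial act s p w].

(** A homogeneous element is commuted to the right through the letters of a word until it meets [S],
    which Dhat_+ kills and Dhat_0 preserves. *)
Lemma submodule_neg_words (S : set M) :
  (forall s, S s -> exists e, P e s) ->
  (forall h s, Dhat_deg 0 h -> S s -> S (act h s)) ->
  (forall n x s, 0 < n -> Dhat_deg n x -> S s -> act x s = 0) ->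
  submodule P act (span (neg_words S)).
Proof.
move=> SP S0 Spos; set T := neg_words S.
have subT := subspace_span C M T.
have TP w : T w -> exists e, P e w.
  move=> [n [s [Ss]]]; elim=> [|k {}n x {}w k0 dx _ [e Pw]]; first exact: SP.
  by exists (hodd (- k%:Z) (+) e); exact: (mod_parity Mmod).
have Tneg (k : nat) x w : (0 < k)%N -> Dhat_deg (- k%:Z) x ->
    span T w -> span T (act x w).
  move=> k0 dx Tw; have Dx := Dhat_deg_Dhat _ _ _ dx.
  have xlin c p q : act x (c *: p + q) = c *: act x p + act x q.
    exact: (mod_linear_r Mmod).
  apply: span_mono (span_linear_image _ _ _ _ _ xlin Tw).
  move=> _ [y [n [s [Ss sy]]] <-]; exists (k + n)%N, s; split=> //.
  exact: neg_monomial_cons.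
(* The degree is quantified inside the induction on words, because the bracket with a letter changes
   it. *)
have Thom w : T w -> forall n x, Dhat_deg n x -> span T (act x w).
  move=> [n [s [Ss]]]; elim=> [|k {}n y {}w k0 dy sw IHw] a x dx.
    have [a0|a0|a0] := ltrgtP 0 a.
    - by rewrite (Spos _ _ _ a0 dx Ss); case: subT.
    - apply: (Tneg `|a|%N); [lia| |apply: span_gen; exists 0%N, s; split=> //].
        by have -> : - `|a|%N%:Z = a by lia.
      exact: neg_monomial_nil.
    - apply: span_gen; exists 0%N, (act x s); split; last exact: neg_monomial_nil.
      by apply: S0 => //; rewrite a0.
  rewrite (act_commute _ _ _ _ _ dx dy); apply: (subspaceD _ _ _ _ _ subT).
    exact: (IHw _ _ (hat_bracket_deg _ _ _ _ _ dx dy)).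
  by apply: subspaceZ => //; apply: Tneg dy _ => //; exact: IHw dx.
split; first exact: graded_span.
move=> x m Dx Tm; suff [] : Dhat x /\ span T (act x m) by [].
apply: (@span_sub _ _ _ [set y | Dhat y /\ span T (act y m)] _ _ x
  (Dhat_span_deg _ _ Dx)); first exact: subspace_act.
move=> y [n dy]; split; first exact: Dhat_deg_Dhat dy.
have Dy := Dhat_deg_Dhat _ _ _ dy.
apply: (@span_sub _ _ T [set w | span T (act y w)]) Tm; last first.
  by move=> w Tw; exact: Thom dy.
split=> [|c p q Tp Tq]; first by rewrite /= act0r //; case: subT.
by rewrite /= (mod_linear_r Mmod) //; apply: subT.2.
Qed.

(** * Weights and singular vectors of a highest weight module *)

Section HighestWeight.
Variables (xi : glhat R -> C) (v : M).
Hypothesis v_hw : is_hw_vector act xi v.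

(* Elements of degree -k/2: the element diag(i) of the Cartan subalgebra
   recovers the grading of a highest weight module. *)
Definition wt (k : int) : set M :=
  [set m | act (dgr R) m = (xi (dgr R) + k%:~R) *: m].

Lemma wt_subspace k : subspace (wt k).
Proof.
have Dd := Dhat_deg_Dhat _ _ _ (dgr_deg R).
split=> [|c x y wx wy]; first by rewrite /wt /= act0r // scaler0.
rewrite /wt /= (mod_linear_r Mmod) // wx wy scalerDr !scalerA.
by rewrite [c * _]mulrC.
Qed.

Lemma wt_act n k x m : Dhat_deg n x -> wt k m -> wt (k - n) (act x m).
Proof.
move=> dx wm; rewrite /wt /= (act_commute _ _ _ _ _ (dgr_deg R) dx) /= scale1r.
rewrite (bracket_dgr _ _ _ dx) actZl ?wm; last exact: Dhat_deg_Dhat dx.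
rewrite actZr; last exact: Dhat_deg_Dhat dx.
by rewrite -scalerDl; congr (_ *: _); rewrite !rmorphD rmorphN /=; ring.
Qed.

Lemma wt_neg_monomial s k (n : nat) w :
  wt k s -> neg_monomial act s n w -> wt (k + n%:Z) w.
Proof.
move=> ws; elim=> [|j {}n x {}w j0 dx _ IHw]; first by rewrite addr0.
have -> : k + (j + n)%N%:Z = k + n%:Z - (- j%:Z) by lia.
exact: wt_act.
Qed.

(** Applying [dgr R] minus the eigenvalue of the first summand removes that summand and multiplies
    the total by [a - k], which is non-zero; induction on the number of summands follows. *)
Lemma wt_independent a m :
  wt a m -> span [set w | exists2 k, k != a & wt k w] m -> m = 0.
Proof.
have Dd := Dhat_deg_Dhat _ _ _ (dgr_deg R).
suff H p (s : 'I_p -> M) : (forall i, exists2 k, k != a & wt k (s i)) ->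
    wt a (\sum_i s i) -> \sum_i s i = 0.
  move=> + [p [c [s [ks E]]]]; rewrite E; apply: H => i.
  have [k ka ws] := ks i; exists k => //.
  exact: subspaceZ (wt_subspace k) ws.
elim: p s => [|p IHp] s ks; first by rewrite big_ord0.
set t := \sum_i s i => wt_t; have [k ka wk] := ks ord0.
pose s' i := act (dgr R) (s (lift ord0 i)) -
             (xi (dgr R) + k%:~R) *: s (lift ord0 i).
have E : \sum_i s' i = (a - k)%:~R *: t.
  transitivity (act (dgr R) t - (xi (dgr R) + k%:~R) *: t); last first.
    by rewrite wt_t -scalerBl; congr (_ *: _); rewrite rmorphB /=; ring.
  rewrite /t big_ord_recl actDr // scalerDr wk opprD addrACA subrr add0r.
  by rewrite act_sumr // scaler_sumr -sumrB.
have /eqP : (a - k)%:~R *: t = 0.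
  rewrite -E; apply: IHp; last by rewrite E; apply: subspaceZ wt_t; exact: wt_subspace.
  move=> i; have [j ja wj] := ks (lift ord0 i); exists j => //.
  by rewrite /s' wj -scalerBl; apply: subspaceZ wj; exact: wt_subspace.
by rewrite scaler_eq0 intr_eq0 subr_eq0 eq_sym (negbTE ka) => /eqP.
Qed.

Lemma wt_hw : wt 0 v.
Proof. by case: v_hw => _ hv _ _; rewrite /wt /= addr0; exact: hv (dgr_deg R). Qed.

(** Among the words applied to [v] only the empty one has weight 0, so [m] is a multiple of [v]
    modulo the other weights, and [wt_independent] removes the rest. *)
Lemma wt0_line m : wt 0 m -> exists c : C, m = c *: v.
Proof.
move=> wm; have [_ _ _ Uv] := v_hw.
set W := span [set w | exists2 k, k != 0 & wt k w].
have subW : subspace W by exact: subspace_span.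
have [c Wc] : exists c : C, W (m - c *: v).
  have : U_neg act v m by rewrite Uv.
  apply: (@span_sub _ _ _ [set m | exists c : C, W (m - c *: v)]).
    split=> [|d x y [c1 W1] [c2 W2]].
      by exists 0; rewrite scale0r subr0; case: subW.
    exists (d * c1 + c2); rewrite scalerDl opprD addrACA -scalerA -scalerBr.
    exact: subW.2.
  move=> w [[|n] vw].
    exists 1; rewrite (neg_monomial0 _ _ vw) scale1r subrr; by case: subW.
  exists 0; rewrite scale0r subr0; apply: span_gen; exists n.+1%:Z => //.
  by have := wt_neg_monomial _ _ _ _ wt_hw vw; rewrite add0r.
exists c; apply/eqP; rewrite -subr_eq0; apply/eqP; apply: wt_independent Wc.
rewrite -scaleN1r scalerA addrC; apply: (wt_subspace 0).2 => //.
exact: wt_hw.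
Qed.

(** Since [dgr R] is even, the even part of [v] has weight 0 and is a multiple of [v]: either [v] is
    even, or this part is zero and [v] is odd. *)
Lemma hw_homogeneous : exists e, P e v.
Proof.
have [subP dec] := mod_superspace Mmod.
have [[p q] [/= [Pp Pq E] _]] := dec v.
have dd := dgr_deg R; have Dd := Dhat_deg_Dhat _ _ _ dd.
have [c pc] : exists c : C, p = c *: v.
  apply: wt0_line; rewrite /wt /= addr0.
  have Pd e m : P e m -> P e (act (dgr R) m).
    by move=> Pm; have := mod_parity Mmod dd Pm.
  have [] // := parity_unique (act (dgr R) p) (act (dgr R) q)
    (xi (dgr R) *: p) (xi (dgr R) *: q); try exact: Pd.
  - by apply: subspaceZ Pp; exact: subP.
  - by apply: subspaceZ Pq; exact: subP.
  - rewrite -actDr // -scalerDr -E; have := wt_hw.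
    by rewrite /wt /= addr0.
have [c0|c0] := eqVneq c 0.
  by exists true; rewrite E pc c0 scale0r add0r.
exists false; rewrite (_ : v = c^-1 *: p); last by rewrite pc scalerA mulVf ?scale1r.
by apply: subspaceZ Pp; exact: subP.
Qed.

Hypothesis Mirr : irreducible P act.

(** All singular vectors of parity [e] and weight [k] are taken together, so that Dhat_0 preserves
    the set. The submodule they generate has only weights at least [k > 0], so it misses [v] and
    must be zero. *)
Lemma singular_eq0 e (k : int) s : 0 < k -> P e s -> wt k s ->
  (forall n x, 0 < n -> Dhat_deg n x -> act x s = 0) -> s = 0.
Proof.
move=> k0 Ps ws s_sing; have [v0 _ _ _] := v_hw.
pose S := [set t | [/\ P e t, wt k t &
  forall n x, 0 < n -> Dhat_deg n x -> act x t = 0]].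
have Ssub : submodule P act (span (neg_words S)).
  apply: submodule_neg_words.
  - by move=> t [Pt _ _]; exists e.
  - move=> h t dh [Pt wtt t_sing]; split.
    + by have := mod_parity Mmod dh Pt.
    + by have := wt_act _ _ _ _ dh wtt; rewrite subr0.
    + move=> n x n0 dx; rewrite (act_commute _ _ _ _ _ dx dh).
      have dxh := hat_bracket_deg _ _ _ _ _ dx dh.
      rewrite (t_sing _ _ _ dxh) ?addr0 // (t_sing _ _ n0 dx).
      by rewrite act0r ?scaler0 ?addr0 //; exact: Dhat_deg_Dhat dh.
  - by move=> n x t n0 dx [_ _ t_sing]; exact: t_sing dx.
have sS : span (neg_words S) s.
  by apply: span_gen; exists 0%N, s; split=> //; exact: neg_monomial_nil.
case: (Mirr.2 _ Ssub) => E; first by move: sS; rewrite E.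
case/eqP: v0; apply: (wt_independent 0); first exact: wt_hw.
have : span (neg_words S) v by rewrite E.
apply: span_mono => w [n [t [[_ wtt _] tw]]]; exists (k + n%:Z); first by lia.
exact: wt_neg_monomial wtt tw.
Qed.

(** * Highest weights of finite support *)

Section FiniteSupport.
Variable N : nat.
(** In degree 0 the band is [|2 * i| <= 4 * N], that is, doubled indices up to [2 * N], or true
    indices up to [N]. *)
Hypothesis xi_far : forall h, far R 0 (4 * N)%N%:Z h -> xi h = 0.

Lemma far_kills_hw (k : nat) x :
  (0 < k)%N -> far R (- k%:Z) (4 * N + k)%N%:Z x -> act x v = 0.
Proof.
have [_ hv v_pos _] := v_hw.
elim/ltn_ind: k x => k IHk x k0 fx; have [e Pv] := hw_homogeneous.
have [dx _ _] := fx; apply: (singular_eq0 (hodd (- k%:Z) (+) e) k%:Z).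
- by lia.
- exact: (mod_parity Mmod dx Pv).
- by have := wt_act _ _ _ _ dx wt_hw; rewrite sub0r opprK.
move=> n y n0 dy; have Dx := Dhat_deg_Dhat _ _ _ dx.
have := act_commute _ _ _ _ v dx dy; rewrite (v_pos _ _ n0 dy) act0r //.
have am : `|- k%:Z| <= (4 * N + k)%N%:Z by lia.
have fb := far_bracket _ _ _ _ _ _ am fx dy; have [db _ _] := fb.
suff -> : act (hat_bracket x y) v = 0.
  by move/esym/eqP; rewrite add0r scaler_eq0 signr_eq0 => /eqP.
(* The bracket has degree [n - k] and loses [n] from the bound [4 * N + k]. For [n < k] this is the
   bound of the induction hypothesis, for [n = k] that of [xi_far]; for [n > k] the degree is
   positive. *)
have [nk|nk|nk] := ltrgtP n k%:Z.
- apply: (IHk (k - `|n|)%N); [by lia|by lia|].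
  have -> : - (k - `|n|)%N%:Z = - k%:Z + n by lia.
  by apply: far_mono fb; lia.
- by apply: v_pos db; lia.
- have nk0 : - k%:Z + n = 0 by lia.
  rewrite nk0 in db fb; rewrite hv // xi_far ?scale0r //.
  by apply: far_mono fb; lia.
Qed.

(** Passing a letter of degree [- j] loses [j] from the bound, while the bracket, of degree
    [- (k + j)], requires [j] more; hence the term [2 * n]. *)
Lemma far_kills_word (n : nat) w : neg_monomial act v n w ->
  forall (k : nat) x, (0 < k)%N ->
    far R (- k%:Z) (4 * N + k + 2 * n)%N%:Z x -> act x w = 0.
Proof.
elim=> [|j {}n y {}w j0 dy _ IHw] k x k0 fx.
  by apply: far_kills_hw k0 _; rewrite muln0 addn0 in fx.
have [dx _ _] := fx; have Dy := Dhat_deg_Dhat _ _ _ dy.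
rewrite (act_commute _ _ _ _ w dx dy) [act x w](IHw k) //; last first.
  by apply: far_mono fx; lia.
rewrite act0r // scaler0 addr0.
have am : `|- k%:Z| <= (4 * N + k + 2 * (j + n))%N%:Z by lia.
apply: (IHw (k + j)%N); first by lia.
have -> : - (k + j)%N%:Z = - k%:Z + - j%:Z by lia.
by apply: far_mono (far_bracket _ _ _ _ _ _ am fx dy); lia.
Qed.

Lemma hw_component_finite_dim (n : nat) : finite_dim (hw_component act v n).
Proof.
elim/ltn_ind: n => n IHn.
(* The threshold at which [far_kills_word] applies to an element of degree [- k] acting on a word of
   degree [- (n - k)]. *)
pose bound k := (4 * N + k + 2 * (n - k))%N.
pose G k := [set y | exists2 j, j \in near_idx (- k%:Z) (bound k) &
  (act (sym_unit R (- k%:Z) j) @` neg_monomial act v (n - k)) y].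
apply: (@finite_dim_sub _ _ _
    ([set v] `|` [set y | exists2 k, k \in iota 1 n & G k y])).
  apply: finite_dimU.
    by exists 1%N, (fun=> v) => _ ->; apply: span_gen; exists ord0.
  apply: finite_dim_bigcup => k; rewrite mem_iota => kn.
  apply: finite_dim_bigcup => j _; apply: finite_dim_image.
    move=> c p q; apply: (mod_linear_r Mmod).
    exact: Dhat_deg_Dhat (sym_unit_deg R _ _).
  apply: (@finite_dim_sub _ _ _ (hw_component act v (n - k))).
    by apply: IHn; lia.
  by move=> w vw; do 2 apply: span_gen.
apply: span_sub; first exact: subspace_span.
move=> w vw; suff [->|[k [kn Gw]]] : w = v \/ exists k, k \in iota 1 n /\ span (G k) w.
- by apply: span_gen; left.
- by apply: span_mono Gw => y Gy; right; exists k.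
case: vw @bound @G {IHn} => [|k {}n x {}w k0 dx vw] bound G; first by left.
right; exists k; split; first by rewrite mem_iota; lia.
have kN0 : - k%:Z != 0 by lia.
(* The far part of the first letter kills the remaining word, which leaves finitely many [sym_unit]
   terms. *)
have [c] := far_decomp _ _ (bound k) _ dx kN0; set x' := \sum_(j <- _) _ => fx.
have Dj j : Dhat (sym_unit R (- k%:Z) j) := Dhat_deg_Dhat _ _ _ (sym_unit_deg R _ _).
have Dcj j : Dhat (c j *: sym_unit R (- k%:Z) j).
  by apply: subspaceZ => //; exact: subspace_Dhat.
have Dx' : Dhat x' by apply: subspace_sum => //; exact: subspace_Dhat.
have [dfx _ _] := fx.
rewrite -[x](subrK x') actDl //; last exact: Dhat_deg_Dhat dfx.
rewrite (far_kills_word _ _ vw k _ k0) ?add0r; last first.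
  by move: fx; rewrite /bound addKn.
rewrite act_suml // big_seq; apply: (big_ind (span (G k))).
- by case: (subspace_span _ _ (G k)).
- by move=> p q; apply: subspaceD; exact: subspace_span.
move=> j jr; rewrite actZl //; apply: subspaceZ; first exact: subspace_span.
by apply: span_gen; exists j => //; exists w => //; rewrite addKn.
Qed.

End FiniteSupport.

(** * Annihilators of the highest weight vector in degree -1/2 *)

Section PolynomialElement.

(** Rows 0 and 1 are excluded by [sym]. The mirror of a row [i >= 2] is [1 - i < 0], so the cutoff
    makes the coefficient there exactly [p.[i%:~R]], without doubling. *)
Definition lower_elt (p : {poly C}) : glhat R :=
  (hmat R (- 1) (sym R (- 1) (fun i => if 2 <= i then p.[i%:~R] else 0)), 0).

Lemma lower_elt_deg p : Dhat_deg (- 1) (lower_elt p).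
Proof. by apply: hmat_Dhat_deg => //; apply: sym_hcoef. Qed.

Lemma lower_elt_linear (c : C) (p q : {poly C}) :
  lower_elt (c *: p + q) = c *: lower_elt p + lower_elt q.
Proof.
rewrite pair_linE; congr pair; last by rewrite /= scaler0 addr0.
apply/funext => i; apply/funext => j.
rewrite fun2_linE /= !hmatE.
case: (j =P _) => _; last by rewrite mulr0 addr0.
rewrite /sym; case: (_ || _); first by rewrite mulr0 addr0.
have E k : (if 2 <= k then (c *: p + q).[k%:~R] else 0) =
    c * (if 2 <= k then p.[k%:~R] else 0) + (if 2 <= k then q.[k%:~R] else 0).
  by case: ifP; rewrite ?hornerE // mulr0 addr0.
by rewrite !E !mulrDr addrACA [refl_coef _ _ _ * (c * _)]mulrCA.
Qed.

(* Solves [f i = g i * p (i + 1) + p i * g (i - 1)] in g by recursion on i;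
   the division by a possible root is harmless where [f] vanishes. *)
Fixpoint raise_coef (p : {poly C}) (f : int -> C) (i : nat) : C :=
  if i is j.+1 then
    (f i%:Z - p.[i%:R] * raise_coef p f j) / p.[i.+1%:R]
  else 0.

Lemma hcoef0_eq (f g : int -> C) : hcoef R 0 f -> hcoef R 0 g ->
  (forall i : nat, (0 < i)%N -> f i = g i) -> f = g.
Proof.
move=> hf hg fg; have [[f0 _ _] [g0 _ _]] := (hf, hg).
apply/funext => i; have [i0|i0|->] := ltrgtP i 0; last by rewrite f0 g0.
  rewrite (hcoef_refl _ _ _ _ hf) (hcoef_refl _ _ _ _ hg) addr0.
  have -> : - i = `|i|%N%:Z by lia.
  by rewrite fg //; lia.
have -> : i = `|i|%N%:Z by lia.
by rewrite fg //; lia.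
Qed.

Lemma lower_elt_kills (p : {poly C}) (n0 : nat) h :
  (forall i : nat, (n0 < i)%N -> p.[i%:R] != 0) -> act (lower_elt p) v = 0 ->
  Dhat_deg 0 h -> h.2 = 0 -> (forall i : nat, (0 < i <= n0)%N -> h.1 i i = 0) ->
  xi h = 0.
Proof.
have [v0 hv v_pos _] := v_hw; move=> pn0 pv dh h2 h_n0.
have [f [hf hE _]] := Dhat_degP _ _ _ dh.
have fn0 i : (0 < i <= n0)%N -> f i = 0.
  by move=> /h_n0; rewrite hE hmatE addr0 eqxx.
have raise0 i : (i <= n0)%N -> raise_coef p f i = 0.
  elim: i => //= i IHi i_n0; rewrite IHi; last exact: ltnW.
  by rewrite fn0 // mulr0 subrr mul0r.
have raiseE (i : nat) : (0 < i)%N ->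
    f i = raise_coef p f i * p.[i.+1%:R] + p.[i%:R] * raise_coef p f i.-1.
  case: i => // i _; have [i_n0|n0_i] := leqP i.+1 n0.
    by rewrite fn0 // !raise0 ?mul0r ?mulr0 ?addr0 //; exact: ltnW.
  by rewrite /= divfK ?subrK // pn0 // ltnW.
(* The mirror of a row [i >= 1] is negative, so [g] agrees with [raise_coef] at positive rows; at
   row 0 both are 0. *)
set g := sym R 1 (fun i => if 1 <= i then raise_coef p f `|i|%N else 0).
have hg : hcoef R 1 g by exact: sym_hcoef.
have db : Dhat_deg 1 ((hmat R 1 g, 0) : glhat R) by exact: hmat_Dhat_deg.
have dl := lower_elt_deg p.
have Eh : h = hat_bracket (hmat R 1 g, 0) (lower_elt p).
  rewrite /lower_elt hat_bracket_hmat addrN [h]surjective_pairing h2 hE.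
  congr pair; last first.
    (* In degree 1 only the entry in row 0 crosses the origin, and it is zero; thus the bracket has
       no central term, as [h.2 = 0] demands. *)
    rewrite alpha_hmat0 // => _ i [] ii; last by lia.
    have -> : i = 0 by lia.
    by case: hg => -> _ _; rewrite mul0r.
  congr hmat; apply: hcoef0_eq => //.
    by rewrite -(addrN 1); apply: brk_hcoef => //; exact: sym_hcoef.
  move=> i i0; rewrite raiseE // /brk /= expr1 mulN1r opprK.
  have gE (j : nat) : g j = raise_coef p f j.
    rewrite /g /sym; case: j => [|j] //=.
    by rewrite mulr0 addr0.
  have lE (j : nat) : (1 < j)%N ->
      sym R (- 1) (fun i => if 2 <= i then p.[i%:~R] else 0) j = p.[j%:R].
    move=> j1; rewrite /sym; have -> : (2 <= - (j%:Z + - 1)) = false by lia.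
    have -> : (j%:Z == 0) || (j%:Z == - - 1) = false by lia.
    by rewrite mulr0 addr0; have -> : 2 <= j%:Z by lia.
  have -> : i%:Z + 1 = i.+1%:Z by lia.
  have -> : i%:Z + -1 = i.-1%:Z by lia.
  rewrite !gE lE //; congr (_ + _).
  (* In row 1 the coefficient of [lower_elt p] is 0 rather than the value of [p], but it multiplies
     [raise_coef p f 0 = 0]. *)
  case: i i0 => [|[|i]] // _; first by rewrite !mulr0.
  by rewrite lE.
apply/eqP; have /eqP := hv _ dh.
rewrite {1}Eh (mod_bracket Mmod _ db dl) pv (v_pos _ _ _ db) //.
rewrite !act0r; try exact: Dhat_deg_Dhat; last exact: Dhat_deg_Dhat db.
  by rewrite scaler0 subrr eq_sym scaler_eq0 (negbTE v0) orbF.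
exact: Dhat_deg_Dhat dl.
Qed.

End PolynomialElement.

End HighestWeight.
End Modules.

Theorem theorem4p9 (R : realType) (M : lmodType R[i]) (P : bool -> set M)
    (act : glhat R -> M -> M) (xi : glhat R -> R[i]) (v : M)
    (Mmod : is_Dhat_module P act)
    (Mirr : irreducible P act)
    (xi_lin : linear_on_Dhat0 xi)
    (v_hw : is_hw_vector act xi v) :
  let i := quasi_finite act v in
  let ii := finite_dim [set act x v | x in @Dhat_deg R (-1)] in
  let iii := exists (N : nat) (xi_ : nat -> R[i]) (d : R[i]), (0 < N)%N /\
    forall h : glhat R, Dhat_deg 0 h ->
      xi h = \sum_(1 <= n < (2 * N).+1) xi_ n * omega n%:Z h
             + d * Lambda0 h in
  (i <-> ii) /\ (ii <-> iii).
Proof.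
move=> i ii iii.
have i_ii : i -> ii.
  move=> /(_ 1%N) fin1; apply: finite_dim_sub fin1 _ => _ [x dx <-].
  apply: span_gen; apply: span_gen.
  exact: (neg_monomial_cons (k := 1) (n := 0) _ dx (neg_monomial_nil _ _)).
have ii_iii : ii -> iii.
  move=> fin; pose U p := act (lower_elt R p) v.
  have Ulin c p q : U (c *: p + q) = c *: U p + U q.
    rewrite /U lower_elt_linear (mod_linear_l Mmod) //;
      exact: Dhat_deg_Dhat (lower_elt_deg R _).
  have [|p p0 pv] := finite_dim_poly_kernel _ _ U _ Ulin fin.
    by move=> p; exists (lower_elt R p) => //; exact: lower_elt_deg.
  have [n0 pn0] := poly_nat_roots_bounded _ _ p0.
  (* For [n > 0] the element [sym_unit R 0 n] is the diagonal matrix with 1 at [n] and -1 at [- n],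
     dual to [omega n]. The successor makes the bound positive, and [2 * n0.+1] exceeds [n0]. *)
  exists n0.+1, (fun n => xi (sym_unit R 0 n)), (xi (0, 1)); split=> // h dh.
  have [D0 Dl] := subspace_Dhat_deg R 0.
  have dc : Dhat_deg 0 ((0, 1) : glhat R).
    by split=> //; case: (subspace_Dhat R).
  have xi_sum (r : seq nat) (c : nat -> R[i]) y : Dhat_deg 0 y ->
      xi (\sum_(n <- r) c n *: sym_unit R 0 n + y) =
      \sum_(n <- r) c n * xi (sym_unit R 0 n) + xi y.
    move=> dy; elim: r => [|n r IHr]; first by rewrite !big_nil !add0r.
    rewrite !big_cons -!addrA xi_lin ?IHr //; first exact: sym_unit_deg.
    apply: subspaceD => //; apply: subspace_sum => // k.
    by apply: subspaceZ => //; exact: sym_unit_deg.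
  set r := index_iota 1 _; set s := \sum_(n <- r) h.1 n n *: sym_unit R 0 n.
  (* Removing from [h] its central part and its entries up to the bound leaves an element on which
     [xi] vanishes by [lower_elt_kills]. *)
  pose h' := (- 1) *: (h.2 *: (0, 1) + s) + h.
  have ds : Dhat_deg 0 s.
    apply: subspace_sum => // k.
    by apply: subspaceZ => //; exact: sym_unit_deg.
  have dsc : Dhat_deg 0 (h.2 *: (0, 1) + s) by exact: Dl.
  have dh' : Dhat_deg 0 h' by exact: Dl.
  have sE : s = (\sum_(n <- r) h.1 n n *:
      (hmat R 0 (sym R 0 (fun i => (i == n)%:R)) : int -> int -> R[i]^o), 0).
    rewrite -sum_pairl; apply: eq_bigr => n _.
    by congr pair; rewrite /= scaler0.
  have hE : h = s + (h.2 *: (0, 1) + h').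
    by rewrite addrA /h' scaleN1r [s + _]addrC addNKr.
  have xi_h' : xi h' = 0.
    apply: (lower_elt_kills _ _ _ _ Mmod _ _ v_hw p n0) => //.
      rewrite /h' !pair_linE sE /=.
      by rewrite addr0 scaleN1r -[_ *: 1]/(_ * 1) mulr1 addNr.
    move=> k /andP[k0 k_n0]; rewrite /h' !glhat_linE sE /= mulr0 add0r mat_sumE.
    have kr : k \in r by rewrite mem_index_iota; lia.
    rewrite (bigD1_seq _ kr (iota_uniq _ _)) /=.
    have symE (n : nat) : (h.1 n n *: (hmat R 0 (sym R 0 (fun i => (i == n)%:R))
        : int -> int -> R[i]^o)) k k = h.1 n n * (k == n)%:R.
      rewrite -[LHS]/(h.1 n n * hmat R 0 _ k k) hmatE addr0 eqxx /sym.
      have -> : (k%:Z == 0) || (k%:Z == - 0) = false by lia.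
      have -> : (- (k%:Z + 0) == n%:Z) = false by lia.
      by rewrite mulr0 addr0.
    rewrite symE eqxx mulr1 big1 ?addr0 ?mulN1r ?addNr // => n nk.
    by rewrite symE eq_sym (negbTE nk) mulr0.
  rewrite {1}hE xi_sum; last by apply: Dl => //; exact: dc.
  rewrite xi_lin // xi_h' addr0 mulrC [_ * h.2]mulrC; congr (_ + _).
  by apply: eq_bigr => k _; rewrite mulrC.
have iii_i : iii -> i.
  move=> [N [xi_ [d [N0 xiE]]]] n.
  apply: (hw_component_finite_dim _ _ _ _ Mmod _ _ v_hw Mirr N) => h [dh fh h2].
  rewrite xiE // /Lambda0 h2 mulr0 addr0 big_nat big1 // => k kN.
  by rewrite /omega -{2}[k%:Z]addr0 fh ?mulr0 //; lia.
by split; split=> // ?; [exact/iii_i/ii_iii|exact/i_ii/iii_i].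
Qed.
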